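(* Let $\mathsf a=(\mathsf a_{\ell,\ell'})_{\ell,\ell'\ge0}$, $\mathsf b=(\mathsf b_\ell)_{\ell\ge0}$, $\mathsf d=(\mathsf d_{\ell,\ell'})_{\ell,\ell'\ge0}$, $\mathsf e=(\mathsf e_\ell)_{\ell\ge0}$ be indeterminates, and for $n\ge0$ define $$B_n(\mathsf a,\mathsf b,\mathsf d,\mathsf e)=\sum_{\pi\in\Pi_n}\;\prod_{i\in\mathrm{openers}}\mathsf a_{\mathrm{cr}(i,\pi),\,\mathrm{ne}(i,\pi)}\prod_{i\in\mathrm{closers}}\mathsf b_{\mathrm{qne}(i,\pi)}\prod_{i\in\mathrm{insiders}}\mathsf d_{\mathrm{cr}(i,\pi),\,\mathrm{ne}(i,\pi)}\prod_{i\in\mathrm{singletons}}\mathsf e_{\mathrm{qne}(i,\pi)},$$ $$B^{(2)}_n(\mathsf a,\mathsf b,\mathsf d,\mathsf e)=\sum_{\pi\in\Pi_n}\;\prod_{i\in\mathrm{openers}}\mathsf a_{\mathrm{ov}(i,\pi),\,\mathrm{cov}(i,\pi)}\prod_{i\in\mathrm{closers}}\mathsf b_{\mathrm{qne}(i,\pi)}\prod_{i\in\mathrm{insiders}}\mathsf d_{\mathrm{ov}(i,\pi),\,\mathrm{cov}(i,\pi)}\prod_{i\in\mathrm{singletons}}\mathsf e_{\mathrm{qne}(i,\pi)}.$$ Then $B^{(2)}_n(\mathsf a,\mathsf b,\mathsf d,\mathsf e)=B_n(\mathsf a,\mathsf b,\mathsf d,\mathsf e)$ for all $n\ge0$. In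 particular, $$\sum_{n=0}^\infty B^{(2)}_n(\mathsf a,\mathsf b,\mathsf d,\mathsf e)\,t^n=\cfrac{1}{1-\gamma_0 t-\cfrac{\beta_1t^2}{1-\gamma_1t-\cfrac{\beta_2t^2}{1-\gamma_2 t-\cdots}}}$$ with coefficients $\gamma_n=\mathsf d^\star_{n-1}+\mathsf e_n$ ($n\ge0$) and $\beta_n=\mathsf a^\star_{n-1}\,\mathsf b_{n-1}$ ($n\ge1$), where $\mathsf a^\star_{n-1}=\sum_{\ell=0}^{n-1}\mathsf a_{\ell,n-1-\ell}$ and likewise for $\mathsf d$ (so $\mathsf d^\star_{-1}=0$).
   Context: $\Pi_n$ is the set of partitions of $[n]=\{1,\dots,n\}$ into nonempty blocks. Continued fractions are identities of formal power series in $t$. For $\pi\in\Pi_n$, an element $i\in[n]$ is an opener if it is the smallest element of a block of size $\ge2$; a closer if it is the largest element of a block of size $\ge2$; an insider if it is a non-opener non-closer element of a block of size $\ge3$; a singleton if it is the sole element of a block of size 1. $\mathcal G_\pi$ is the graph on vertex set $[n]$ whose edges join consecutive elements within the same block; edges are written $(i,j)$ with $i<j$. For $j\in[n]$ define $\mathrm{cr}(j,\pi)=\#\{i<j<k<l:\ (i,k)\in\mathcal G_\pi,\ (j,l)\in\mathcal G_\pi\}$, $\mathrm{ne}(j,\pi)=\#\{i<j<k<l:\ (i,l)\in\mathcal G_\pi,\ (j,k)\in\mathcal G_\pi\}$, $\mathrm{qne}(j,\pi)=\#\{i<j<l:\ (i,l)\in\mathcal G_\pi\}$ (in each case $j$ is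 fixed and the other indices vary). With $B_1,B_2$ ranging over blocks of $\pi$, define also $\mathrm{ov}(j,\pi)=\#\{(B_1,B_2):\ j\in B_2\text{ and }\min B_1<j<\max B_1<\max B_2\}$, $\mathrm{cov}(j,\pi)=\#\{(B_1,B_2):\ j\in B_2\text{ and }\min B_1<j<\max B_2<\max B_1\}$. *)

(* Defs.v *)
From HB Require Import structures.
From mathcomp Require Import all_boot all_order all_algebra.
Set Implicit Arguments.
Unset Strict Implicit.
Unset Printing Implicit Defensive.
Import GRing.Theory.
Local Open Scope ring_scope.

(* [n] is represented by 'I_n = {0, ..., n-1}; every notion below depends only
   on the order of the ground set.  A set partition is P : {set {set 'I_n}}
   with [partition P [set: 'I_n]], and [pblock P i] is the block containing i. *)

Section SetPartitions.
Local Open Scope nat_scope.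
Variable n : nat.
Implicit Types (B : {set 'I_n}) (P : {set {set 'I_n}}) (i j k l : 'I_n).

(* The default values n and 0 are returned only when B is empty; see bminP and
   bmaxP. *)
Definition bmin B : nat := \big[minn/n]_(i in B) i.
Definition bmax B : nat := \max_(i in B) i.

Lemma bminP B : B != set0 ->
  (exists2 i : 'I_n, i \in B & bmin B = i) /\ (forall i, i \in B -> bmin B <= i).
Proof.
have lb i : i \in B -> bmin B <= i.
  move=> Bi; have: i \in [seq k <- index_enum 'I_n | k \in B].
    by rewrite mem_filter Bi mem_index_enum.
  rewrite /bmin -big_filter; elim: [seq _ <- _ | _] => //= x s IHs.
  rewrite big_cons inE => /orP[/eqP<- | /IHs]; first exact: geq_minl.
  by apply: leq_trans; apply: geq_minr.
case/set0Pn=> i0 Bi0; split=> //.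
have lt_n : bmin B < n by apply: leq_ltn_trans (lb _ Bi0) (ltn_ord i0).
have: bmin B = n \/ exists2 i : 'I_n, i \in B & bmin B = i.
  rewrite /bmin.
  apply: (big_ind (fun m => m = n \/ exists2 i : 'I_n, i \in B & m = i)).
  - by left.
  - by move=> x y Hx Hy; rewrite /minn; case: ifP.
  - by move=> i Bi; right; exists i.
by case=> // e; rewrite e ltnn in lt_n.
Qed.

Lemma bmaxP B : B != set0 ->
  (exists2 i : 'I_n, i \in B & bmax B = i) /\ (forall i, i \in B -> i <= bmax B).
Proof.
case/set0Pn=> i0 Bi0; split; last by move=> i Bi; apply: leq_bigmax_cond.
have Bgt0 : 0 < #|B| by apply/card_gt0P; exists i0.
by have [i Bi e] := eq_bigmax_cond (fun i : 'I_n => i : nat) Bgt0; exists i.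
Qed.

Definition opener P i := (1 < #|pblock P i|) && (i == bmin (pblock P i) :> nat).
Definition closer P i := (1 < #|pblock P i|) && (i == bmax (pblock P i) :> nat).
Definition insider P i :=
  [&& 2 < #|pblock P i|, ~~ opener P i & ~~ closer P i].
Definition singleton P i := #|pblock P i| == 1.

Definition edge P i j :=
  [&& i < j, j \in pblock P i & [forall k in pblock P i, ~~ (i < k < j)]].

Definition cr j P := #|[set x : 'I_n * 'I_n * 'I_n |
  let: (i, k, l) := x in [&& i < j, j < k, k < l, edge P i k & edge P j l]]|.

Definition ne j P := #|[set x : 'I_n * 'I_n * 'I_n |
  let: (i, k, l) := x in [&& i < j, j < k, k < l, edge P i l & edge P j k]]|.

Definition qne j P := #|[set x : 'I_n * 'I_n |
  let: (i, l) := x in [&& i < j, j < l & edge P i l]]|.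

Definition ov j P := #|[set x : {set 'I_n} * {set 'I_n} |
  let: (B1, B2) := x in [&& B1 \in P, B2 \in P, j \in B2,
    bmin B1 < j, j < bmax B1 & bmax B1 < bmax B2]]|.

Definition cov j P := #|[set x : {set 'I_n} * {set 'I_n} |
  let: (B1, B2) := x in [&& B1 \in P, B2 \in P, j \in B2,
    bmin B1 < j, j < bmax B2 & bmax B2 < bmax B1]]|.

End SetPartitions.

Section Polynomials.
Variable R : comNzRingType.
Implicit Types (a d : nat -> nat -> R) (b e : nat -> R).

Definition Bpoly a b d e n : R :=
  \sum_(P : {set {set 'I_n}} | partition P [set: 'I_n])
    (\prod_(i | opener P i) a (cr i P) (ne i P)) *
    (\prod_(i | closer P i) b (qne i P)) *
    (\prod_(i | insider P i) d (cr i P) (ne i P)) *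
    (\prod_(i | singleton P i) e (qne i P)).

Definition Bpoly2 a b d e n : R :=
  \sum_(P : {set {set 'I_n}} | partition P [set: 'I_n])
    (\prod_(i | opener P i) a (ov i P) (cov i P)) *
    (\prod_(i | closer P i) b (qne i P)) *
    (\prod_(i | insider P i) d (ov i P) (cov i P)) *
    (\prod_(i | singleton P i) e (qne i P)).

Definition star (x : nat -> nat -> R) n : R := \sum_(l < n.+1) x l (n - l)%N.

Definition gamma d e n : R := (if n is m.+1 then star d m else 0) + e n.

(* Used only for 1 <= n. *)
Definition beta a b n : R := star a n.-1 * b n.-1.

End Polynomials.

Section FormalPowerSeries.
Variable R : comNzRingType.

(* f : fps is the series \sum_n f n t^n. *)
Definition fps := nat -> R.
Implicit Types (f g u : fps).

Definition fps_one : fps := fun n => (n == 0%N)%:R.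
Definition fps_mul f g : fps := fun n => \sum_(i < n.+1) f i * g (n - i)%N.
Definition fps_exp f k : fps := iter k (fps_mul f) fps_one.

(* 1 / (1 - u) = \sum_k u^k for u with zero constant term; u^k does not
   contribute to the coefficient of t^n when k > n. *)
Definition fps_inv1B u : fps := fun n => \sum_(k < n.+1) fps_exp u k n.

Lemma fps_exp_small u k n : u 0%N = 0 -> (n < k)%N -> fps_exp u k n = 0.
Proof.
move=> u0; elim: k n => // k IHk n lt_nk; rewrite /fps_exp /= -/(fps_exp u k).
rewrite /fps_mul big1 // => -[[|i] /= lt_in] _; first by rewrite u0 mul0r.
rewrite IHk ?mulr0 //; rewrite !ltnS in lt_in lt_nk.
by apply: leq_trans lt_nk; rewrite -subSn // leq_subLR addSn ltnS leq_addl.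
Qed.

Lemma fps_inv1BP u n : u 0%N = 0 ->
  fps_mul (fun k => fps_one k - u k) (fps_inv1B u) n = fps_one n.
Proof.
move=> u0; rewrite /fps_mul.
under eq_bigr do rewrite mulrBl.
rewrite sumrB big_ord_recl /= subn0 {1}/fps_one eqxx mul1r big1 ?addr0; last first.
  by move=> i _; rewrite /fps_one /= mul0r.
have -> : \sum_(i < n.+1) u i * fps_inv1B u (n - i)%N
        = \sum_(k < n.+1) fps_exp u k.+1 n.
  rewrite [RHS](eq_bigr (fun k : 'I_n.+1 =>
    \sum_(i < n.+1) u i * fps_exp u k (n - i)%N)) // exchange_big /=.
  apply: eq_bigr => i _; rewrite -mulr_sumr; congr (_ * _).
  rewrite /fps_inv1B (big_ord_widen n.+1 (fun k => fps_exp u k (n - i)%N)); last first.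
    by rewrite ltnS leq_subr.
  rewrite big_mkcond /=; apply: eq_bigr => k _; case: ifP => // /negbT.
  by rewrite -leqNgt => /(fps_exp_small u0) ->.
rewrite /fps_inv1B big_ord_recl [X in _ - X]big_ord_recr /=.
rewrite -[fps_mul u (fps_exp u n)]/(fps_exp u n.+1) fps_exp_small // addr0.
by under eq_bigr do rewrite add0n; rewrite addrK.
Qed.

(* The convergent of depth N of the continued fraction starting at level m:
   jconv N.+1 m = 1 / (1 - c_m t - b_{m+1} t^2 jconv N m.+1). *)
Fixpoint jconv (c b : nat -> R) (N m : nat) : fps :=
  if N is N'.+1 then
    fps_inv1B (fun n => match n with
                        | 0 => 0
                        | 1 => c m
                        | k.+2 => b m.+1 * jconv c b N' m.+1 k
                        end)
  else fun=> 0.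

(* Convergence of formal power series: each coefficient is eventually constant. *)
Definition fps_cvg (F : nat -> fps) (f : fps) :=
  forall n, exists N0, forall N, (N0 <= N)%N -> F N n = f n.

(* f = 1 / (1 - c_0 t - b_1 t^2 / (1 - c_1 t - b_2 t^2 / (1 - c_2 t - ...))) *)
Definition is_jfraction (f : fps) (c b : nat -> R) :=
  fps_cvg (fun N => jconv c b N 0) f.

End FormalPowerSeries.

(* Main.v *)
Require Import Defs.
From mathcomp Require Import all_boot all_order all_algebra.
From mathcomp Require Import zify ring.
Set Implicit Arguments.
Unset Strict Implicit.
Unset Printing Implicit Defensive.
Import GRing.Theory.

(** Both polynomials are transfer-matrix sums over weighted Motzkin paths with
    the same weights, and such sums are coefficients of a J-fraction.

    Read a partition P from the largest element down to the smallest.  Cutting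
    just below m leaves a partial partition: the traces on {m, m+1, ...} of the
    blocks of P ([restr P m]), some of which are still pending because their
    block also has elements below m ([pend P m]).  The next element j either
    starts a new trace, and is then a singleton or a closer of P, or enters a
    pending trace C, and is then an opener or an insider, according to whether
    the trace obtained remains pending.  All these choices are free
    ([join_eq]).

    The weight of j is determined by the choice alone.  If j starts a new
    trace, qne(j) is the number k of pending traces, because every one of them
    is linked to the elements below j by exactly one edge passing over j.  If j
    enters C, the edge leaving j to the right ends at min C; the other pending
    traces D are again crossed by one edge each, with right end min D, and
    cr(j), ne(j) count the D for which min D is smaller, respectively larger,
    than min C.  Likewise ov(j), cov(j) count the pending D for which max D is
    smaller, respectively larger, than max C, because the maximum of a pending
    block is the maximum of its trace.

    So the two families of statistics differ only by the key, minimum or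
    maximum, by which the pending traces are ranked.  When C runs over the k
    pending traces its rank takes each value 0, ..., k-1 once whatever the key
    is, and the contributions of C sum to a*_{k-1} or d*_{k-1} ([sum_ranks]).
    The sum over all partitions extending a partial partition therefore depends
    only on the position of the cut and on k, and obeys the recursion of
    Motzkin paths at height k with level weight d*_{k-1} + e_k, up weight b_k
    and down weight a*_{k-1} ([sum_restr]).

    The continued fraction is Flajolet's theorem ([motzkin_jfraction]): a path
    from height k to 0 is cut at its last visit to each of the heights
    k, k-1, ..., 1, which writes the generating function of these paths as a
    product of continued fraction tails. *)

(** * Motzkin paths and J-fractions *)

Section JFraction.
Local Open Scope ring_scope.
Variable R : comNzRingType.
Implicit Types (f g h : fps R) (c u v b : nat -> R).

(** The coefficient of t^n in a product involves only finitely many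
    coefficients, so associativity of the product of series is inherited from
    polynomials. *)
Lemma fps_mul_coef f g N n : (n < N)%N ->
  fps_mul f g n = (\poly_(i < N) f i * \poly_(i < N) g i)`_n.
Proof.
move=> ltnN; rewrite coefM; apply: eq_bigr => i _.
by rewrite !coef_poly !(leq_ltn_trans _ ltnN) ?leq_subr // -ltnS.
Qed.

Lemma fps_mulA f g h n :
  fps_mul f (fps_mul g h) n = fps_mul (fps_mul f g) h n.
Proof.
have E (p q : fps R) (P Q : {poly R}) : (forall i, (i <= n)%N -> p i = P`_i) ->
    (forall i, (i <= n)%N -> q i = Q`_i) -> fps_mul p q n = (P * Q)`_n.
  move=> eP eQ; rewrite coefM; apply: eq_bigr => i _.
  by rewrite eP ?eQ ?leq_subr // -ltnS.
pose tr (k : fps R) := \poly_(i < n.+1) k i.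
have T (k : fps R) i : (i <= n)%N -> k i = (tr k)`_i by move=> lein; rewrite coef_poly ltnS lein.
have M p q i : (i <= n)%N -> fps_mul p q i = (tr p * tr q)`_i.
  by move=> lein; apply: fps_mul_coef.
by rewrite (E _ _ _ _ (T f) (M g h)) (E _ _ _ _ (M f g) (T h)) mulrA.
Qed.

Lemma fps_mul1 f n : fps_mul (fps_one R) f n = f n.
Proof.
rewrite /fps_mul big_ord_recl subn0 mul1r big1 ?addr0 // => i _.
by rewrite mul0r.
Qed.

Lemma fps_mulr1 f n : fps_mul f (fps_one R) n = f n.
Proof.
rewrite /fps_mul big_ord_recr /= subnn mulr1 big1 ?add0r // => i _.
by rewrite /fps_one subn_eq0 leqNgt ltn_ord mulr0.
Qed.

(** With J = 1 / (1 - f), this is J = 1 + f J multiplied by g: either a path is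
    over, or it begins with one excursion counted by f. *)
Lemma fps_inv1B_mul f g n : f 0%N = 0 ->
  fps_mul (fps_inv1B f) g n = g n + fps_mul f (fps_mul (fps_inv1B f) g) n.
Proof.
move=> f0; set J := fps_inv1B f.
have JE i : J i = fps_one R i + fps_mul f J i.
  rewrite -(fps_inv1BP i f0) -/J -{1}[J i]fps_mul1 -[X in _ = _ + X]opprK.
  apply/eqP; rewrite eq_sym subr_eq -sumrB; apply/eqP/eq_bigr => l _.
  by rewrite mulrBl.
rewrite fps_mulA -(fps_mul1 g n) -big_split /=.
by apply: eq_bigr => i _; rewrite JE mulrDl.
Qed.

Definition fps_shift (x : R) f : fps R := fun n => if n is m.+1 then x * f m else 0.

Section Motzkin.
Variables c u v : nat -> R.

(** The weighted count of n-step Motzkin paths from height k to 0, by first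
    step: level, up or down. *)
Fixpoint motzkin n k : R :=
  if n is m.+1 then
    c k * motzkin m k + u k * motzkin m k.+1
    + (if k is l.+1 then v l * motzkin m l else 0)
  else (k == 0%N)%:R.

Let b n := v n.-1 * u n.-1.

(** The generating function of the paths from height k to 0 of height less than
    N: a path that stays at height at least k, a down step, and then a path
    from k - 1 to 0. *)
Fixpoint descents N k : fps R :=
  fps_mul (jconv c b (N - k) k)
    (if k is l.+1 then fps_shift (v l) (descents N l) else fps_one R).

(** The first-step recursion holds for [descents].  An up step from k followed
    by a path from k + 1 to 0 is an arch over height k (a coefficient of
    b_{k+1} t^2 J_{k+1}) followed by a path from k to 0, since
    b_{k+1} = v_k u_k. *)
Lemma descentsE N k n : (k < N)%N ->
  descents N k n = if n is m.+1 then
    c k * descents N k m + u k * descents N k.+1 m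
    + (if k is l.+1 then v l * descents N l m else 0)
  else (k == 0%N)%:R.
Proof.
move=> ltkN; set D := descents N k.
pose g := if k is l.+1 then fps_shift (v l) (descents N l) else fps_one R.
have DE : D = fps_mul (jconv c b (N - k) k) g by rewrite /D /g; case: (k).
set J' := jconv c b (N - k.+1) k.+1.
have D'E : descents N k.+1 = fps_mul J' (fps_shift (v k) D) by [].
pose U n := match n with 0 => 0 | 1 => c k | l.+2 => b k.+1 * J' l end.
have JE : jconv c b (N - k) k = fps_inv1B U by rewrite -(subnSK ltkN).
rewrite JE in DE; rewrite DE fps_inv1B_mul // -DE.
clearbody D; case: n => [|n].
  rewrite /fps_mul big_ord1 mul0r addr0 /g; case: (k) => //.
rewrite D'E addrC /fps_mul big_ord_recl mul0r add0r big_ord_recl /= subSS subn0.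
congr (_ + _ + _); last by rewrite /g; case: (k).
rewrite big_ord_recr /= subnn mulr0 addr0 mulr_sumr.
apply: eq_bigr => i _; rewrite /bump /= !add1n !subSS.
rewrite -(subnSK (ltn_ord i)) /= /b /=.
by rewrite [v k * _]mulrC -!mulrA; congr (_ * _); rewrite mulrCA.
Qed.

(** A path of n steps starting at height k never exceeds n + k, so that the
    height bound N is not felt. *)
Lemma descents_motzkin N n k : (n + k < N)%N -> descents N k n = motzkin n k.
Proof.
elim: n k => [|n IHn] k ltN; rewrite descentsE; try lia; first by [].
rewrite (IHn k) ?(IHn k.+1); try lia.
by case: k ltN => // k ltN; rewrite IHn //; lia.
Qed.

(** Flajolet's theorem: the convergents stabilise because n steps starting at
    height 0 stay below height n + 1. *)
Lemma motzkin_jfraction : is_jfraction (fun n => motzkin n 0%N) c b.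
Proof.
move=> n; exists n.+1 => N ltnN.
by rewrite -(@descents_motzkin N) ?addn0 //= subn0 fps_mulr1.
Qed.
End Motzkin.
End JFraction.

(** * Partial partitions cut below an element *)

Section Cuts.
Variable n : nat.
Implicit Types (B C D : {set 'I_n}) (P Q S X : {set {set 'I_n}}) (i j k l x y : 'I_n).

Definition up m : {set 'I_n} := [set i : 'I_n | m <= i].
Definition restr P m := [set pblock P x :&: up m | x in up m].
Definition pend P m :=
  [set pblock P x :&: up m | x in up m & ~~ (pblock P x \subset up m)].
Definition tail P j := pblock P j :&: up j.+1.
Definition reaches_below P j := ~~ (pblock P j \subset up j).

(** The effect of reading j on a family X of traces: the trace C becomes
    j |: C, which is kept when lw holds.  With C = set0, j starts a new trace. *)
Definition join X C (lw : bool) j :=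
  (if lw then [set j |: C] else set0) :|: (X :\ C).

Lemma upS j : up j = j |: up j.+1.
Proof. by apply/setP=> i; rewrite !inE -val_eqE /= leq_eqVlt eq_sym. Qed.

Lemma mem_join X C lw j D : (forall D, D \in X -> j \notin D) ->
  (D \in join X C lw j) = if j \in D then lw && (D == j |: C) else (D != C) && (D \in X).
Proof.
move=> jX; rewrite 3!inE; case: (boolP (j \in D)) => jD.
  rewrite (negPf (contraL (@jX D) jD)).
  by rewrite andbF orbF; case: lw; rewrite !inE.
by case: lw; rewrite !inE //; case: (D =P j |: C) jD => [->|//]; rewrite setU11.
Qed.

(** Reading j can be undone, because j |: C is the only trace containing j. *)
Lemma joinK X C lw j : (C == set0) || (C \in X) -> set0 \notin X ->
    (forall D, D \in X -> j \notin D) ->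
  X = (if C == set0 then set0 else [set C]) :|: (join X C lw j :\ (j |: C)).
Proof.
move=> XC X0 jX; apply/setP=> D; rewrite 2!inE in_set1 mem_join //.
have [jD|jD] := ifPn (j \in D).
  rewrite (negPf (contraL (@jX D) jD)).
  have -> : (D \in (if C == set0 then set0 else [set C])) = false.
    case: ifPn => C0; rewrite inE //; apply/negP=> /eqP DC.
    by case/orP: XC; rewrite ?(negPf C0) // => /jX; rewrite -DC jD.
  by case: (D =P j |: C); rewrite /= ?andbF.
have -> /= : D != j |: C by apply: contraNneq jD => ->; rewrite setU11.
case: (eqVneq C set0) XC => [-> _|C0 /= XC].
  by rewrite inE; case: (D =P set0) => [->|] //=; apply: negPf.
by rewrite inE; case: (D =P C) => [->|].
Qed.

Section Partition.
Variable P : {set {set 'I_n}}.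
Hypothesis partP : partition P [set: 'I_n].

Lemma pblock_self x : x \in pblock P x.
Proof. by rewrite mem_pblock (cover_partition partP) inE. Qed.

Lemma pblock_eq x y : y \in pblock P x -> pblock P y = pblock P x.
Proof.
move=> yx; apply: same_pblock => //; exact: partition_trivIset partP.
Qed.

Lemma pblock_in x : pblock P x \in P.
Proof. by rewrite pblock_mem // (cover_partition partP) inE. Qed.

Lemma pblockE B x : B \in P -> x \in B -> B = pblock P x.
Proof.
by move=> PB Bx; rewrite (def_pblock _ PB Bx) //; apply: partition_trivIset partP.
Qed.

Lemma tail_notin j : j \notin tail P j.
Proof. by rewrite !inE ltnn andbF. Qed.

Lemma tail_up j : pblock P j :&: up j = j |: tail P j.
Proof.
rewrite upS setIUr; congr (_ :|: _); apply/setIidPr.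
by rewrite sub1set pblock_self.
Qed.

Lemma restr_notin j D : D \in restr P j.+1 -> j \notin D.
Proof. by case/imsetP=> x _ ->; rewrite !inE ltnn andbF. Qed.

Lemma pend_sub_restr m : pend P m \subset restr P m.
Proof.
by apply/subsetP=> _ /imsetP[x /setIdP[xm _] ->]; apply: imset_f.
Qed.

Lemma pend_notin j D : D \in pend P j.+1 -> j \notin D.
Proof. by move/(subsetP (pend_sub_restr _))/restr_notin. Qed.

Lemma restr_neq0 m : set0 \notin restr P m.
Proof.
by apply/imsetP=> [[x xm /setP/(_ x)]]; rewrite in_set0 inE pblock_self xm.
Qed.

(** A trace that j enters was pending, since its block contains j. *)
Lemma tail_pend j : (tail P j == set0) || (tail P j \in pend P j.+1).
Proof.
have [//|/set0Pn[x /setIP[xj jx]]] := eqVneq; apply/orP; right.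
apply/imsetP; exists x; last by rewrite (pblock_eq xj).
rewrite inE jx (pblock_eq xj); apply/subsetPn; exists j; first exact: pblock_self.
by rewrite inE ltnn.
Qed.

Lemma setIupS j x : j \notin pblock P x -> pblock P x :&: up j = pblock P x :&: up j.+1.
Proof.
move=> jx; rewrite upS setIUr (_ : _ :&: [set j] = set0) ?set0U //.
by apply/eqP; rewrite setI_eq0 disjoint_sym disjoints1.
Qed.

Lemma subupS j x : j \notin pblock P x ->
  (pblock P x \subset up j) = (pblock P x \subset up j.+1).
Proof.
by move=> jx; apply/setIidPl/setIidPl; rewrite setIupS.
Qed.

Lemma tail_block j x : x \in up j.+1 ->
  (pblock P x :&: up j.+1 == tail P j) = (j \in pblock P x).
Proof.
move=> xj; apply/eqP/idP => [/setP/(_ x)|/pblock_eq xE]; last by rewrite /tail xE.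
rewrite /tail !in_setI xj pblock_self !andbT => /esym jx.
by rewrite (pblock_eq jx) pblock_self.
Qed.

(** Blocks not containing j have the same trace before and after j is read. *)
Lemma restr_join j : restr P j = join (restr P j.+1) (tail P j) true j.
Proof.
apply/setP=> D; rewrite mem_join /=; last exact: restr_notin.
case: ifPn => jD.
  apply/imsetP/eqP => [[x xj DE]|->]; last first.
    by exists j; rewrite ?inE // tail_up.
  move: jD; rewrite DE !inE leqnn andbT => /pblock_eq <-; exact: tail_up.
apply/imsetP/andP => [[x xj DE]|[DT /imsetP[x xj DE]]].
  have jx : j \notin pblock P x by move: jD; rewrite DE !inE leqnn andbT.
  have xj' : x \in up j.+1.
    by move: xj; rewrite upS !inE => /orP[/eqP xj|//]; rewrite xj pblock_self in jx.
  rewrite DE setIupS // tail_block // jx; split=> //; exact: imset_f.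
exists x; first by rewrite upS inE xj orbT.
by rewrite setIupS // -tail_block // -DE.
Qed.

Lemma pend_join j : pend P j = join (pend P j.+1) (tail P j) (reaches_below P j) j.
Proof.
apply/setP=> D; rewrite mem_join /=; last exact: pend_notin.
case: ifPn => jD.
  apply/imsetP/andP => [[x /setIdP[xj xl] DE]|[lj /eqP->]]; last first.
    by exists j; rewrite ?inE ?leqnn // tail_up.
  move: jD; rewrite DE !inE leqnn andbT => /pblock_eq jx.
  by rewrite /reaches_below jx -jx tail_up jx eqxx.
apply/imsetP/andP => [[x /setIdP[xj xl] DE]|[DT /imsetP[x /setIdP[xj xl] DE]]].
  have jx : j \notin pblock P x by move: jD; rewrite DE !inE leqnn andbT.
  have xj' : x \in up j.+1.
    by move: xj; rewrite upS !inE => /orP[/eqP xj|//]; rewrite xj pblock_self in jx.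
  rewrite DE setIupS // tail_block // jx; split=> //; apply: imset_f.
  by rewrite inE xj' -subupS.
have jx : j \notin pblock P x by rewrite -tail_block // -DE.
exists x; last by rewrite setIupS.
by rewrite inE subupS // xl upS inE xj orbT.
Qed.

(** The choice (C, lw) made at j and the state before j determine the state
    after j, and conversely: a partition reaches the updated state if and only
    if it reached (Q, S) and made that choice. *)
Lemma join_eq Q S C lw j : partition Q (up j.+1) -> S \subset Q ->
    (C == set0) || (C \in S) ->
  (restr P j == join Q C true j) && (pend P j == join S C lw j)
  = [&& restr P j.+1 == Q, pend P j.+1 == S, tail P j == C & reaches_below P j == lw].
Proof.
move=> partQ SQ SC.
have jQ D : D \in Q -> j \notin D.
  by move/(partitionS partQ)/subsetP=> DQ; apply/negP=> /DQ; rewrite inE ltnn.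
have jS D : D \in S -> j \notin D by move/(subsetP SQ)/jQ.
have jC : j \notin C by case/orP: SC => [/eqP->|/jS]; rewrite ?inE.
apply/andP/and4P => [[/eqP Qe /eqP Se]|[/eqP Qe /eqP Se /eqP Te /eqP Le]]; last first.
  by rewrite -Qe -Se -Te -Le restr_join pend_join.
have Te : tail P j = C.
  have : j |: tail P j \in restr P j.
    by rewrite restr_join mem_join ?setU11 ?eqxx //; apply: restr_notin.
  rewrite Qe mem_join // setU11 /= => /eqP/setP TC; apply/setP=> x.
  move: (TC x); rewrite !in_setU1; case: (x =P j) => [->|//] _.
  by rewrite (negPf (tail_notin j)) (negPf jC).
have Le : reaches_below P j = lw.
  have : (j |: tail P j \in pend P j) = reaches_below P j.
    by rewrite pend_join mem_join ?setU11 ?eqxx ?andbT //; apply: pend_notin.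
  by rewrite Se Te mem_join // setU11 eqxx andbT.
have Q0 : set0 \notin Q by rewrite (partition0 partQ).
rewrite Te Le !eqxx; split=> //; apply/eqP.
  rewrite (@joinK (restr P j.+1) (tail P j) true j) ?restr_neq0 -?restr_join //.
  - rewrite Qe Te -joinK //; case/orP: SC => [->//|/(subsetP SQ)->]; exact: orbT.
  - case/orP: (tail_pend j) => [->//|/(subsetP (pend_sub_restr _))->]; exact: orbT.
  - exact: restr_notin.
rewrite (@joinK (pend P j.+1) (tail P j) (reaches_below P j) j) -?pend_join //.
- by rewrite Se Te -joinK //; apply: contra (subsetP SQ _) Q0.
- exact: tail_pend.
- by apply: contra (subsetP (pend_sub_restr _) _) (restr_neq0 _).
- exact: pend_notin.
Qed.

End Partition.

Lemma join_partition Q C j : partition Q (up j.+1) -> (C == set0) || (C \in Q) ->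
  partition (join Q C true j) (up j).
Proof.
move=> partQ QC; rewrite /join.
have CQ : C \subset up j.+1 by case/orP: QC => [/eqP->|/(partitionS partQ)]; rewrite ?sub0set.
have -> : up j = (j |: C) :|: (up j.+1 :\: C).
  by rewrite -setUA setDE setUIr setUCr setIT (setUidPr CQ) upS.
apply: partitionU1; last 1 first.
- rewrite disjoints_subset subUset sub1set !inE ltnn andbF /=.
  by rewrite setCD subsetUr.
- case/orP: QC => [/eqP->|QC]; last exact: partitionD1.
  by rewrite setD0 (setDidPl _) // disjoint_sym disjoints1 (partition0 partQ).
- by apply/set0Pn; exists j; rewrite setU11.
Qed.

Lemma join_sub Q S C lw j : S \subset Q -> join S C lw j \subset join Q C true j.
Proof. by move=> SQ; apply: setUSS; [case: lw; rewrite ?sub0set | apply: setSD]. Qed.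

Lemma card_join S C lw j : (C == set0) || (C \in S) -> set0 \notin S ->
    (forall D, D \in S -> j \notin D) ->
  #|join S C lw j| = lw + #|S| - (C != set0).
Proof.
move=> SC S0 jS; rewrite /join.
have nS : j |: C \notin S :\ C.
  by rewrite inE; apply/negP=> /andP[_ /jS]; rewrite setU11.
have -> : #|(if lw then [set j |: C] else set0) :|: S :\ C| = lw + #|S :\ C|.
  by case: lw; rewrite ?set0U // cardsU1 nS.
rewrite (cardsD1 C S); case: eqVneq SC => [->|_ /= ->]; last by rewrite addnCA addKn.
by rewrite (negPf S0) subn0.
Qed.

End Cuts.

(** * Ranks *)

Section Ranks.
Variables (T : finType) (key : T -> nat).
Implicit Types (S : {set T}) (C D : T).

Definition below S C := #|[set D in S | key D < key C]|.
Definition above S C := #|[set D in S | key C < key D]|.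

Lemma below_above S C : {in S &, injective key} -> C \in S ->
  below S C + above S C = #|S|.-1.
Proof.
move=> inj SC; rewrite (cardsD1 C S) SC /= /below /above -cardsUI.
have -> : [set D in S | key D < key C] :&: [set D in S | key C < key D] = set0.
  by apply/setP=> D; rewrite !inE; case: ltngtP; rewrite !andbF.
rewrite cards0 addn0.
apply: eq_card => D; rewrite !inE; case: (boolP (D \in S)) => SD; rewrite ?andbF //=.
case: ltngtP => // [lt|lt|/inj->//]; rewrite ?eqxx // andbT; apply/esym/eqP=> DC.
  by rewrite DC ltnn in lt.
by rewrite DC ltnn in lt.
Qed.

Lemma below_inj S : {in S &, injective key} -> {in S &, injective (below S)}.
Proof.
move=> inj.
have lt C D : key C < key D -> C \in S -> below S C < below S D.
  move=> ltCD SC; apply: proper_card; apply/properP; split.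
    by apply/subsetP=> E /setIdP[SE ltE]; rewrite inE SE (ltn_trans ltE).
  by exists C; rewrite !inE SC ?ltCD // ltnn.
move=> C D SC SD eqCD; apply: inj => //.
by case: (ltngtP (key C) (key D)) => [/lt/(_ SC)|/lt/(_ SD)|//]; rewrite eqCD ltnn.
Qed.

(** The number of elements with smaller key is a bijection from S to
    {0, ..., k}, whatever the key is. *)
Lemma sum_ranks (R : comNzRingType) (a : nat -> nat -> R) S k :
  {in S &, injective key} -> #|S| = k.+1 ->
  (\sum_(C in S) a (below S C) (above S C) = star a k)%R.
Proof.
move=> inj cS; pose r C : 'I_k.+1 := inord (below S C).
have ltr C : C \in S -> below S C < k.+1.
  by move=> SC; rewrite ltnS -[k]/(k.+1.-1) -cS -(below_above inj SC) leq_addr.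
have rE C : C \in S -> r C = below S C :> nat by move=> SC; rewrite inordK ?ltr.
have r_inj : {in S &, injective r}.
  by move=> C D SC SD /(congr1 val); rewrite /= !rE //; apply: below_inj.
have rT : r @: S = setT.
  by apply/eqP; rewrite eqEcard subsetT cardsT card_ord card_in_imset ?cS /=.
have -> : (star a k = \sum_(l in r @: S) a l (k - l)%N)%R.
  by apply: eq_bigl => l; rewrite rT inE.
rewrite big_imset //=; apply: eq_bigr => C SC; rewrite rE //; congr (a _ _).
by rewrite -[k]/(k.+1.-1) -cS -(below_above inj SC) addKn.
Qed.
End Ranks.

(** * The transfer recursion *)

Section Transfer.
Variable R : comNzRingType.
Variables (a d : nat -> nat -> R) (b e : nat -> R).
Variables (n : nat) (key : {set 'I_n} -> nat).
Hypothesis keyP : forall B, B != set0 -> exists2 i : 'I_n, i \in B & key B = i.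
Implicit Types (C : {set 'I_n}) (P Q S : {set {set 'I_n}}) (j : 'I_n).
Local Open Scope ring_scope.

(** The weight of reading an element when the pending traces are S: it starts a
    new trace if C = set0, and otherwise enters the pending trace C. *)
Definition letter_wt S C (lw : bool) : R :=
  if C == set0 then (if lw then b #|S| else e #|S|)
  else (if lw then d else a) (below key S C) (above key S C).

Definition wt P j := letter_wt (pend P j.+1) (tail P j) (reaches_below P j).

(** The key of a set is one of its elements, so disjoint sets have different
    keys. *)
Lemma key_inj Q S (D : {set 'I_n}) : partition Q D -> S \subset Q ->
  {in S &, injective key}.
Proof.
move=> partQ /subsetP SQ C E /SQ QC /SQ QE eqk.
have [i Ci ki] := keyP (partition_neq0 partQ QC).
have [l El kl] := keyP (partition_neq0 partQ QE).
have il : i = l by apply: val_inj; rewrite /= -ki -kl.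
have tQ := partition_trivIset partQ.
by rewrite -(def_pblock tQ QC Ci) -(def_pblock tQ QE El) il.
Qed.

Let part P := partition P [set: 'I_n].

(** Partitions with a given state are sorted by the choice made at the next
    element; on each class the weight of that element is constant. *)
Lemma sum_letters Q S (j : 'I_n) (F : {set {set 'I_n}} -> R) :
    partition Q (up n j.+1) -> S \subset Q ->
  \sum_(P | part P && ((restr P j.+1 == Q) && (pend P j.+1 == S))) wt P j * F P =
  \sum_(C | (C == set0) || (C \in S)) \sum_(lw : bool) letter_wt S C lw *
     \sum_(P | part P && ((restr P j == join Q C true j) && (pend P j == join S C lw j))) F P.
Proof.
move=> partQ SQ; rewrite pair_big_dep /=.
rewrite (partition_big (fun P => (tail P j, reaches_below P j))
  (fun c => ((c.1 == set0) || (c.1 \in S)) && true)) /=; last first.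
  by move=> P /andP[partP /andP[_ /eqP<-]]; rewrite andbT tail_pend.
apply: eq_bigr => -[C lw] /=; rewrite andbT => SC; rewrite mulr_sumr.
apply: eq_big => [P|P].
  case: (boolP (part P)) => //= partP.
  by rewrite join_eq // -!andbA xpair_eqE.
move=> /andP[/andP[_ /andP[_ /eqP<-]]] /eqP[<- <-]; by [].
Qed.

(** The sum over the completions of a partial partition depends only on the
    position m of the cut and on the number of pending traces: each of the
    m elements left is one step of a Motzkin path whose height is that
    number. *)
Lemma sum_restr m Q S : (m <= n)%N -> partition Q (up n m) -> S \subset Q ->
  \sum_(P | part P && ((restr P m == Q) && (pend P m == S)))
     \prod_(i : 'I_n | (i < m)%N) wt P i
  = motzkin (gamma d e) b (star a) m #|S|.
Proof.
elim: m Q S => [|m IHm] Q S lemn partQ SQ.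
  (* At the cut below 0 the state is P itself with nothing pending, so the sum
     has one term or none. *)
  have up0 : up n 0 = setT by apply/setP=> i; rewrite !inE.
  have restr0 P : part P -> restr P 0 = P.
    move=> partP; apply/setP=> B; rewrite /restr up0.
    apply/imsetP/idP => [[x _ ->]|PB]; first by rewrite setIT pblock_in.
    have /set0Pn[x Bx] := partition_neq0 partP PB.
    by exists x; rewrite ?inE // setIT (pblockE partP PB Bx).
  have pend0 P : pend P 0 = set0.
    apply/setP=> B; rewrite inE; apply/negbTE/imsetP=> [[x]].
    by rewrite up0 inE subsetT andbF.
  rewrite (eq_bigl (fun P => (P == Q) && (S == set0))) => [|P]; last first.
    rewrite pend0 (eq_sym set0) andbA; congr (_ && _).
    have [partP|npP] := boolP (part P); first by rewrite restr0.
    by apply/esym/eqP=> PQ; rewrite PQ /part -up0 partQ in npP.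
  rewrite /= cards_eq0; case: (S == set0); last by rewrite big_pred0 // => P; rewrite andbF.
  rewrite (big_pred1 Q) => [|P]; last by rewrite andbT.
  by rewrite big_pred0.
pose j := Ordinal lemn.
rewrite (eq_bigr (fun P => wt P j * \prod_(i : 'I_n | (i < j)%N) wt P i)) => [|P _]; last first.
  rewrite (bigD1 j) //=; congr (_ * _); apply: eq_bigl => i.
  by rewrite -val_eqE /= ltnS [RHS]ltn_neqAle andbC.
rewrite (@sum_letters Q S j (fun P => \prod_(i : 'I_n | (i < j)%N) wt P i) partQ SQ).
have Q0 : set0 \notin Q by rewrite (partition0 partQ).
have S0 : set0 \notin S by apply: contra (subsetP SQ _) Q0.
have jQ D : D \in Q -> j \notin D.
  by move/(partitionS partQ)/subsetP=> DQ; apply/negP=> /DQ; rewrite inE ltnn.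
have jS D : D \in S -> j \notin D by move/(subsetP SQ)/jQ.
pose M := motzkin (gamma d e) b (star a) m.
transitivity (\sum_(C | (C == set0) || (C \in S)) \sum_(lw : bool)
   letter_wt S C lw * M (lw + #|S| - (C != set0))%N).
  apply: eq_bigr => C SC; apply: eq_bigr => lw _; rewrite IHm ?card_join //.
  - exact: ltnW.
  - apply: join_partition => //; case/orP: SC => [->//|/(subsetP SQ)->]; exact: orbT.
  - exact: join_sub.
rewrite (bigD1 set0) ?eqxx //= big_bool /letter_wt eqxx /= !subn0.
rewrite (eq_bigl (fun C => C \in S)) => [|C]; last first.
  by case: eqVneq => [->|]; rewrite /= ?(negPf S0) ?andbT.
have inj := key_inj partQ SQ.
have -> : \sum_(C in S) \sum_(lw : bool) (if C == set0 then if lw then b #|S| else e #|S|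
       else (if lw then d else a) (below key S C) (above key S C)) *
       M (lw + #|S| - (C != set0))%N
  = (\sum_(C in S) d (below key S C) (above key S C)) * M #|S| +
    (\sum_(C in S) a (below key S C) (above key S C)) * M #|S|.-1.
  rewrite !mulr_suml -big_split; apply: eq_bigr => C SC /=.
  have /negPf-> : C != set0 by apply: contraNneq S0 => <-.
  by rewrite big_bool /= add0n add1n !subn1.
rewrite -/M /gamma; case cS : #|S| => [|k].
  by rewrite (cards0_eq cS) !big_set0 /= !mul0r !addr0 !add0r addrC.
rewrite !(sum_ranks _ inj cS) /= -/M add0n add1n.
ring.
Qed.

(** At the cut above all elements the state is empty for every partition. *)
Lemma sum_partitions :
  \sum_(P | part P) \prod_(i : 'I_n) wt P i = motzkin (gamma d e) b (star a) n 0%N.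
Proof.
have upn : up n n = set0 by apply/setP=> i; rewrite !inE leqNgt ltn_ord.
transitivity (motzkin (gamma d e) b (star a) n #|(set0 : {set {set 'I_n}})|).
  rewrite -(@sum_restr n set0 set0) ?sub0set //; last by rewrite upn partition_set0.
  apply: eq_big => [P|P _]; last by apply: eq_bigl => i; rewrite ltn_ord.
  have pend0 : pend P n = set0.
    apply/eqP; have := pend_sub_restr P n; rewrite -subset0 /restr upn imset0 //.
  by rewrite pend0 /restr upn imset0 !eqxx !andbT.
by rewrite cards0.
Qed.
End Transfer.

(** * The statistics as ranks among pending traces *)

Section Statistics.
Variable n : nat.
Implicit Types (B C D : {set 'I_n}) (i j k l x y : 'I_n).

Lemma bmin_le B x : x \in B -> bmin B <= x.
Proof.
move=> Bx; have /bminP[_] : B != set0 by apply/set0Pn; exists x.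
exact.
Qed.

Lemma bmin_in B : B != set0 -> exists2 i : 'I_n, i \in B & bmin B = i.
Proof. by case/bminP. Qed.

Lemma bmax_ge B x : x \in B -> x <= bmax B.
Proof.
move=> Bx; have /bmaxP[_] : B != set0 by apply/set0Pn; exists x.
exact.
Qed.

Lemma bmax_in B : B != set0 -> exists2 i : 'I_n, i \in B & bmax B = i.
Proof. by case/bmaxP. Qed.

Lemma bminE B x : x \in B -> (forall y, y \in B -> x <= y) -> bmin B = x.
Proof.
move=> Bx le; apply/eqP; rewrite eqn_leq bmin_le //=.
have /bmin_in[y By ->] : B != set0 by apply/set0Pn; exists x.
exact: le.
Qed.

Lemma bmaxE B x : x \in B -> (forall y, y \in B -> y <= x) -> bmax B = x.
Proof.
move=> Bx ge; apply/eqP; rewrite eqn_leq bmax_ge // andbT.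
have /bmax_in[y By ->] : B != set0 by apply/set0Pn; exists x.
exact: ge.
Qed.

Variable P : {set {set 'I_n}}.
Hypothesis partP : partition P [set: 'I_n].

Lemma in_tail j x : (x \in tail P j) = (x \in pblock P j) && (j < x).
Proof. by rewrite !inE. Qed.

Lemma bmin_reaches_below j : (j == bmin (pblock P j) :> nat) = ~~ reaches_below P j.
Proof.
rewrite negbK; apply/eqP/subsetP => [jm x jx|sub].
  by rewrite inE jm bmin_le.
by apply/esym/bminE; [exact: pblock_self | move=> y /sub; rewrite inE].
Qed.

Lemma bmax_tail j : (j == bmax (pblock P j) :> nat) = (tail P j == set0).
Proof.
apply/eqP/eqP => [jm|t0].
  apply/setP=> x; rewrite in_tail in_set0; apply/negP=> /andP[/bmax_ge jx].
  by rewrite jm ltnNge jx.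
apply/esym/bmaxE=> [|y jy]; first exact: pblock_self.
by rewrite leqNgt; apply/negP=> lt; have := in_tail j y; rewrite t0 jy lt inE.
Qed.

Lemma card_pblock j :
  #|pblock P j| = (#|pblock P j :\: up n j| + #|tail P j|).+1.
Proof.
rewrite -(cardsID (up n j) (pblock P j)) (tail_up partP) cardsU1 (tail_notin P j).
by rewrite addnC add1n addnS.
Qed.

Lemma reaches_below_card j : reaches_below P j = (0 < #|pblock P j :\: up n j|).
Proof. by rewrite card_gt0 setD_eq0. Qed.

Lemma tail_card j : (tail P j == set0) = (#|tail P j| == 0).
Proof. by rewrite cards_eq0. Qed.

Lemma openerE j : opener P j = (tail P j != set0) && ~~ reaches_below P j.
Proof.
by rewrite /opener bmin_reaches_below card_pblock tail_card reaches_below_card; lia.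
Qed.

Lemma closerE j : closer P j = (tail P j == set0) && reaches_below P j.
Proof.
by rewrite /closer bmax_tail card_pblock tail_card reaches_below_card; lia.
Qed.

Lemma insiderE j : insider P j = (tail P j != set0) && reaches_below P j.
Proof.
by rewrite /insider openerE closerE card_pblock tail_card reaches_below_card; lia.
Qed.

Lemma singletonE j : singleton P j = (tail P j == set0) && ~~ reaches_below P j.
Proof.
by rewrite /singleton card_pblock tail_card reaches_below_card; lia.
Qed.

Lemma edge_pblock i l : edge P i l -> pblock P i = pblock P l.
Proof. by case/and3P=> _ /(pblock_eq partP). Qed.

Lemma edge_bmin j i l : i < j -> j < l -> edge P i l ->
  bmin (pblock P l :&: up n j.+1) = l.
Proof.
move=> ltij ltjl E; have /and3P[_ _ /forall_inP gap] := E.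
apply: bminE => [|y /setIP[ly]]; first by rewrite !inE (pblock_self partP) ltjl.
rewrite inE => ltjy; rewrite leqNgt; have := gap y.
by rewrite (edge_pblock E) ly (ltn_trans ltij ltjy) => ->.
Qed.

Lemma edge_tail j l : tail P j != set0 -> edge P j l = (l == bmin (tail P j) :> nat).
Proof.
move=> /bmin_in[m mt mE]; rewrite mE; have := mt; rewrite in_tail => /andP[jm ltjm].
apply/and3P/eqP => [[ltjl jl /forall_inP gap]|/val_inj->].
  apply/eqP; rewrite eqn_leq -{2}mE bmin_le ?in_tail ?jl ?ltjl // andbT leqNgt.
  by have := gap m jm; rewrite ltjm.
split=> //; apply/forall_inP=> k jk; apply/negP=> /andP[ltjk].
by rewrite ltnNge -mE bmin_le // in_tail jk ltjk.
Qed.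

(** An edge (i, l) over j corresponds to the pending trace D of the block of
    l: it joins the last element of the block below j to the minimum l of D.
    The trace of the block of j is excluded because the edge of that block
    leaving j does not pass over j. *)
Lemma cut_edges j (r : pred nat) :
  #|[set x : 'I_n * 'I_n | [&& x.1 < j, j < x.2, edge P x.1 x.2 & r x.2]]| =
  #|[set D in pend P j.+1 | (D != tail P j) && r (bmin D)]|.
Proof.
set E := [set x : 'I_n * 'I_n | _]; pose f (x : 'I_n * 'I_n) := pblock P x.2 :&: up n j.+1.
have f_inj : {in E &, injective f}.
  move=> [i l] [i' l']; rewrite !inE /=.
  move=> /and4P[ltij ltjl E1 _] /and4P[ltij' ltjl' E2 _] ff.
  have ll : l = l'.
    apply: val_inj; rewrite /= -(edge_bmin ltij ltjl E1) -/(f (i, l)) ff.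
    exact: edge_bmin ltij' ltjl' E2.
  rewrite ll in E1 *; congr (_, _); apply: val_inj => /=.
  have /and3P[_ _ /forall_inP g1] := E1; have /and3P[_ _ /forall_inP g2] := E2.
  have := g1 i'; have := g2 i; rewrite (edge_pblock E1) (edge_pblock E2).
  rewrite -{1}(edge_pblock E1) -{1}(edge_pblock E2) !(pblock_self partP).
  move=> /(_ isT) + /(_ isT); lia.
rewrite -(card_in_imset f_inj); apply: eq_card => D; apply/imsetP/idP.
  move=> [[i l]]; rewrite inE /= => /and4P[ltij ltjl E1 rl] DE.
  have ltl : l \in up n j.+1 by rewrite inE.
  rewrite inE DE /f /= (edge_bmin ltij ltjl E1) rl andbT; apply/andP; split.
    apply: imset_f; rewrite inE ltl; apply/subsetPn; exists i; last first.
      by rewrite inE -leqNgt ltnW.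
    by rewrite -(edge_pblock E1) (pblock_self partP).
  rewrite (tail_block partP) //; apply/negP=> lj.
  have /and3P[_ _ /forall_inP/(_ j)] := E1.
  by rewrite (edge_pblock E1) lj ltij ltjl => /(_ isT).
case/setIdP=> /imsetP[x /setIdP[xj xl] DE] /andP[Dt rD].
have [y yx yj] := subsetPn xl; rewrite inE -leqNgt in yj.
have jx : j \notin pblock P x by rewrite -(tail_block partP xj) -DE.
have /bmin_in[l lD bD] : D != set0.
  by apply/set0Pn; exists x; rewrite DE inE (pblock_self partP).
have := lD; rewrite DE !inE => /andP[lx ltjl].
(* The left end of the edge is the last element of the block of x before j. *)
pose Q i := (i \in pblock P x) && (i <= j).
have Qy : Q y by rewrite /Q yx -ltnS.
case: (@arg_maxnP _ y Q (fun i => i : nat) Qy) => i /andP[ix leij] imax.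
have ltij : i < j.
  by rewrite ltn_neqAle leij andbT; apply: contraNneq jx => /val_inj<-.
exists (i, l); last by rewrite /f /= (pblock_eq partP lx).
rewrite bD in rD; rewrite inE /= ltij ltjl rD /= andbT.
apply/and3P; split; first exact: ltn_trans ltij ltjl.
  by rewrite (pblock_eq partP ix).
apply/forall_inP=> k; rewrite (pblock_eq partP ix) => kx.
apply/negP=> /andP[ltik]; case: (leqP k j) => [lekj|ltjk].
  have leki : k <= i by apply: imax; rewrite /Q kx.
  by rewrite ltnNge leki in ltik.
by rewrite ltnNge -bD bmin_le // DE !inE kx ltjk.
Qed.

Lemma qneE j : tail P j = set0 -> qne j P = #|pend P j.+1|.
Proof.
move=> t0; transitivity #|[set D in pend P j.+1 | (D != tail P j) && true]|.
  rewrite -(cut_edges j predT); apply: eq_card => -[i l].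
  by rewrite !inE /= andbT.
apply: eq_card => D; rewrite t0 !inE andbT; case: eqVneq => [->|]; last by rewrite andbT.
rewrite andbF; apply/esym/negbTE/(contra (subsetP (pend_sub_restr _ _) _)).
exact: restr_neq0.
Qed.

(** The right neighbour of j in its block is the minimum of the trace that j
    enters, so that both cr and ne compare minima of traces. *)
Lemma crE j : tail P j != set0 -> cr j P = below (@bmin n) (pend P j.+1) (tail P j).
Proof.
move=> t0; have [m mt mE] := bmin_in t0.
transitivity #|[set D in pend P j.+1 | (D != tail P j) && (bmin D < m)]|; last first.
  apply: eq_card => D; rewrite !inE mE; congr (_ && _).
  by case: eqVneq => // ->; rewrite mE ltnn.
rewrite -(cut_edges j (fun k : nat => k < m)).
rewrite -(card_imset _ (_ : injective (fun x : 'I_n * 'I_n => (x, m)))); last first.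
  by move=> x y [].
apply: eq_card => -[[i k] l]; rewrite inE (edge_tail l t0) mE.
apply/idP/imsetP => [/and5P[ltij ltjk ltkl Eik /eqP/val_inj lm]|[[x y]]].
  by exists (i, k); rewrite ?lm // inE /= ltij ltjk Eik -lm.
by rewrite inE /= => /and4P[ltij ltjk Eik ltkm] [-> -> ->]; rewrite ltij ltjk ltkm Eik eqxx.
Qed.

Lemma neE j : tail P j != set0 -> ne j P = above (@bmin n) (pend P j.+1) (tail P j).
Proof.
move=> t0; have [m mt mE] := bmin_in t0.
transitivity #|[set D in pend P j.+1 | (D != tail P j) && (m < bmin D)]|; last first.
  apply: eq_card => D; rewrite !inE mE; congr (_ && _).
  by case: eqVneq => // ->; rewrite mE ltnn.
rewrite -(cut_edges j (fun k : nat => m < k)).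
rewrite -(card_imset _ (_ : injective (fun x : 'I_n * 'I_n => (x.1, m, x.2)))); last first.
  by move=> [x1 x2] [y1 y2] [-> ->].
have := mt; rewrite in_tail => /andP[_ ltjm].
apply: eq_card => -[[i k] l]; rewrite inE (edge_tail k t0) mE.
apply/idP/imsetP => [/and5P[ltij ltjk ltkl Eil /eqP/val_inj km]|[[x y]]].
  by exists (i, l); rewrite ?km // inE /= ltij Eil -km ltkl (ltn_trans ltjk).
rewrite inE /= => /and4P[ltij ltjl Eil ltml] [-> -> ->].
by rewrite ltij ltjm ltml Eil eqxx.
Qed.

(** A nonempty trace retains the maximum of its block; this is why ov and cov
    can be read off before the rest of the block is known. *)
Lemma bmax_cut m x : x \in up n m -> bmax (pblock P x :&: up n m) = bmax (pblock P x).
Proof.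
rewrite inE => lemx; have [y yx yE] := bmax_in (partition_neq0 partP (pblock_in partP x)).
rewrite yE; apply: bmaxE => [|z /setIP[/bmax_ge]]; last by rewrite yE.
by rewrite !inE yx (leq_trans lemx) // -yE bmax_ge // (pblock_self partP).
Qed.

Lemma bmax_pblock_tail j : tail P j != set0 -> bmax (pblock P j) = bmax (tail P j).
Proof.
case/set0Pn=> x; rewrite in_tail => /andP[jx ltjx].
by rewrite /tail -(pblock_eq partP jx) bmax_cut // inE.
Qed.

(** The condition on r excludes the block of j: when j is its minimum, its trace
    above j is pending although the block has no element below j. *)
Lemma cut_blocks j (r : pred nat) : ~~ r (bmax (tail P j)) ->
  #|[set B in P | [&& bmin B < j, j < bmax B & r (bmax B)]]| =
  #|[set D in pend P j.+1 | r (bmax D)]|.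
Proof.
move=> rt; set E := [set B in P | _]; pose f B := B :&: up n j.+1.
have EP B : B \in E -> exists2 x, x \in up n j.+1 & B = pblock P x.
  case/setIdP=> PB /and3P[_ ltjB _].
  have [x Bx mE] := bmax_in (partition_neq0 partP PB).
  by exists x; [rewrite inE -mE | apply: pblockE].
have f_inj : {in E &, injective f}.
  move=> B C /EP[x xj ->] /EP[y yj ->] /setP/(_ x).
  by rewrite !in_setI xj pblock_self // !andbT => /esym/(pblock_eq partP).
rewrite -(card_in_imset f_inj); apply: eq_card => D; apply/imsetP/idP.
  move=> [B EB ->]; have [x xj BE] := EP B EB; have := EB.
  case/setIdP=> PB /and3P[ltBj ltjB rB].
  rewrite inE /f {2}BE bmax_cut // -BE rB andbT BE.
  apply: imset_f; rewrite inE xj -BE; apply/subsetPn.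
  have [y By mE] := bmin_in (partition_neq0 partP PB); exists y => //.
  by rewrite inE -mE -leqNgt ltnW.
case/setIdP=> /imsetP[x /setIdP[xj xl] DE] rD.
have Dt : D != tail P j by apply: contraNneq rt => <-.
have jx : j \notin pblock P x by rewrite -(tail_block partP xj) -DE.
have [y yx] := subsetPn xl; rewrite inE -leqNgt => leyj.
have ltyj : y < j.
  by rewrite ltn_neqAle leyj andbT; apply: contraNneq jx => /val_inj<-.
exists (pblock P x) => //; rewrite inE pblock_in // -(bmax_cut xj) -DE rD.
rewrite (leq_ltn_trans (bmin_le yx) ltyj) DE bmax_cut // andbT.
by rewrite inE in xj; rewrite (leq_trans xj) // bmax_ge // pblock_self.
Qed.

Lemma ovE j : tail P j != set0 -> ov j P = below (@bmax n) (pend P j.+1) (tail P j).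
Proof.
move=> t0; rewrite /below -(@cut_blocks j (fun k : nat => k < bmax (tail P j))) ?ltnn //.
rewrite -(card_imset _ (_ : injective (fun B => (B, pblock P j)))); last by move=> B C [].
apply: eq_card => -[B C]; rewrite inE.
apply/idP/imsetP => [/and5P[PB PC jC ltBj /andP[ltjB ltBC]]|[D]].
  have CE := pblockE partP PC jC.
  by exists B; rewrite -?CE // inE PB ltBj ltjB -bmax_pblock_tail // -CE.
rewrite inE -bmax_pblock_tail // => /and4P[PD ltDj ltjD ltDC] [-> ->].
by rewrite PD pblock_in // pblock_self // ltDj ltjD.
Qed.

Lemma covE j : tail P j != set0 -> cov j P = above (@bmax n) (pend P j.+1) (tail P j).
Proof.
move=> t0; rewrite /above -(@cut_blocks j (fun k : nat => bmax (tail P j) < k)) ?ltnn //.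
have ltjt : j < bmax (tail P j).
  by have [x] := bmax_in t0; rewrite in_tail => /andP[_ ltjx] ->.
rewrite -(card_imset _ (_ : injective (fun B => (B, pblock P j)))); last by move=> B C [].
apply: eq_card => -[B C]; rewrite inE.
apply/idP/imsetP => [/and5P[PB PC jC ltBj /andP[ltjC ltCB]]|[D]].
  have CE := pblockE partP PC jC.
  by exists B; rewrite -?CE // inE PB ltBj (ltn_trans ltjC ltCB) -bmax_pblock_tail // -CE.
rewrite inE -bmax_pblock_tail // => /and4P[PD ltDj _ ltCD] [-> ->].
by rewrite PD pblock_in // pblock_self // ltDj bmax_pblock_tail // ltjt -bmax_pblock_tail.
Qed.

Section Weights.
Variables (R : comNzRingType) (a d : nat -> nat -> R) (b e : nat -> R).
Local Open Scope ring_scope.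

(** Openers, closers, insiders and singletons are exactly the four combinations
    of entering a trace or not and having smaller elements in the block or
    not. *)
Lemma prod_wt (key : {set 'I_n} -> nat) (lo hi : 'I_n -> nat) :
    (forall j, tail P j != set0 -> lo j = below key (pend P j.+1) (tail P j)) ->
    (forall j, tail P j != set0 -> hi j = above key (pend P j.+1) (tail P j)) ->
  \prod_(i | opener P i) a (lo i) (hi i) * \prod_(i | closer P i) b (qne i P) *
  \prod_(i | insider P i) d (lo i) (hi i) * \prod_(i | singleton P i) e (qne i P)
  = \prod_(i : 'I_n) wt a d b e key P i.
Proof.
move=> loE hiE; rewrite (big_mkcond (opener P)) (big_mkcond (closer P)).
rewrite (big_mkcond (insider P)) (big_mkcond (singleton P)) -!big_split /=.
apply: eq_bigr => j _; rewrite /= /wt /letter_wt.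
rewrite openerE closerE insiderE singletonE.
case: eqVneq => [t0|t0] /=; first by case: (reaches_below P j); rewrite ?qneE // ?mul1r ?mulr1.
by rewrite loE // hiE //; case: (reaches_below P j); rewrite ?mul1r ?mulr1.
Qed.
End Weights.
End Statistics.

(** * The two polynomials *)

Section Main.
Variables (R : comNzRingType) (a d : nat -> nat -> R) (b e : nat -> R).
Local Open Scope ring_scope.

Lemma Bpoly_motzkin n : Bpoly a b d e n = motzkin (gamma d e) b (star a) n 0%N.
Proof.
rewrite -(sum_partitions a d b e (@bmin_in n)); apply: eq_bigr => P partP.
by apply: prod_wt => // j; [exact: crE | exact: neE].
Qed.

Lemma Bpoly2_motzkin n : Bpoly2 a b d e n = motzkin (gamma d e) b (star a) n 0%N.
Proof.
rewrite -(sum_partitions a d b e (@bmax_in n)); apply: eq_bigr => P partP.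
by apply: prod_wt => // j; [exact: ovE | exact: covE].
Qed.
End Main.

Theorem theorem3p12 (R : comNzRingType)
    (a : nat -> nat -> R) (b : nat -> R) (d : nat -> nat -> R) (e : nat -> R) :
  (forall n : nat, Bpoly2 a b d e n = Bpoly a b d e n) /\
  is_jfraction (fun n : nat => Bpoly2 a b d e n) (gamma d e) (beta a b).
Proof.
split=> n; first by rewrite Bpoly2_motzkin Bpoly_motzkin.
have [N0 HN] := motzkin_jfraction (gamma d e) b (star a) n.
by exists N0 => N leN; rewrite Bpoly2_motzkin; apply: HN.
Qed.
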